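(* Let $g\ge1$, and fix $u\in\mathbb{R}^g$ and a real symmetric positive definite $g\times g$ matrix $B$. Let $\mu$ and $\Sigma$ be the mean vector and the covariance matrix of the discrete Gaussian distribution $p_\theta(n)=p_\theta(n;u,B)$ on $\mathbb{Z}^g$. Among all probability densities $q(n)$ of support $\mathbb{Z}^g$ with mean vector $\mu$ and covariance matrix $\Sigma$, the distribution $p_\theta$ maximizes entropy.
   Context: Notation: $\mathbf{e}(x)=e^{2\pi x}$. For $u\in\mathbb{R}^g$ and $B$ a real symmetric positive definite matrix, $\theta(u,B)=\sum_{n\in\mathbb{Z}^g}\mathbf{e}(-\frac12 n^tBn+n^tu)$ (the Riemann theta function), and the discrete Gaussian distribution with parameters $(u,B)$ is the probability distribution on $\mathbb{Z}^g$ given by $p_\theta(n;u,B)=\frac{1}{\theta(u,B)}\mathbf{e}(-\frac12 n^tBn+n^tu)$. Densities are with respect to the counting measure on $\mathbb{Z}^g$, and the entropy of $q$ is $H(q)=-\sum_{n\in\mathbb{Z}^g}q(n)\log q(n)$. *)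

(* Defs.v *)
From HB Require Import structures.
From mathcomp Require Import all_boot all_order all_algebra.
From mathcomp Require Import all_classical all_reals all_analysis.
Import Order.TTheory GRing.Theory Num.Theory.

Set Implicit Arguments.
Unset Strict Implicit.
Unset Printing Implicit Defensive.

Local Open Scope classical_set_scope.
Local Open Scope ring_scope.

(* e(x) = exp(2 pi x), without the imaginary unit. *)
Definition ebold (R : realType) (x : R) : R := expR (2 * pi * x).

(* Sum of an absolutely summable real family: [esum] is only meaningful for
   nonnegative terms, so the positive and negative parts are summed separately.
   The value is junk when [summable setT (EFin \o f)] fails. *)
Definition rsum (R : realType) (T : choiceType) (f : T -> R) : R :=
  fine (esum setT (EFin \o f)^\+ - esum setT (EFin \o f)^\-)%E.

Definition posdefmx (R : realType) (g : nat) (B : 'M[R]_g) : Prop :=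
  B^T = B /\ forall x : 'cV[R]_g, x != 0 -> 0 < (x^T *m B *m x) 0 0.

Section DiscreteGaussian.
Variables (R : realType) (g : nat).
Implicit Types (u : 'cV[R]_g) (B : 'M[R]_g) (n : 'cV[int]_g).

Definition realvec n : 'cV[R]_g := map_mx intr n.

Definition theta_term u B n : R :=
  ebold (- (1 / 2) * ((realvec n)^T *m B *m realvec n) 0 0
         + ((realvec n)^T *m u) 0 0).

(* The terms are positive, so [esum] is the sum of the series in [0, +oo];
   [fine] loses nothing when B is positive definite. *)
Definition theta u B : R := fine (\esum_(n in setT) (theta_term u B n)%:E).

Definition p_theta u B n : R := (theta u B)^-1 * theta_term u B n.

End DiscreteGaussian.

Section Densities.
Variables (R : realType) (g : nat).
Implicit Types (q : 'cV[int]_g -> R).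

Definition is_density q : Prop :=
  (forall n, 0 <= q n) /\ \esum_(n in setT) (q n)%:E = 1%E.

Definition full_support q : Prop := [set n | q n != 0] = setT.

Definition mean_term q (i : 'I_g) (n : 'cV[int]_g) : R := q n * (n i 0)%:~R.

Definition mean q : 'cV[R]_g := \col_i rsum (mean_term q i).

Definition cov_term q (i j : 'I_g) (n : 'cV[int]_g) : R :=
  q n * (((n i 0)%:~R - mean q i 0) * ((n j 0)%:~R - mean q j 0)).

Definition covmx q : 'M[R]_g := \matrix_(i, j) rsum (cov_term q i j).

(* The mean vector (covariance matrix) of q exists and equals mu (Sigma). *)
Definition has_mean q (mu : 'cV[R]_g) : Prop :=
  (forall i, summable setT (EFin \o mean_term q i)) /\ mean q = mu.

Definition has_cov q (Sigma : 'M[R]_g) : Prop :=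
  (forall i j, summable setT (EFin \o cov_term q i j)) /\ covmx q = Sigma.

(* -sum q log q, with the sign inside the sum: for a density q all the terms
   are nonnegative (0 <= q n <= 1), so the entropy always exists in [0, +oo]. *)
Definition entropy q : \bar R := \esum_(n in setT) (- (q n * ln (q n)))%:E.

(* The densities of support Z^g with mean mu and covariance Sigma. *)
Definition moment_class (mu : 'cV[R]_g) (Sigma : 'M[R]_g)
    : set ('cV[int]_g -> R) :=
  [set q | [/\ is_density q, full_support q, has_mean q mu & has_cov q Sigma]].

(* p lies in C and its entropy is a real number, the largest on C. *)
Definition maximizes_entropy (C : set ('cV[int]_g -> R))
    (p : 'cV[int]_g -> R) : Prop :=
  [/\ C p, entropy p \is a fin_num
    & forall q, C q -> (entropy q <= entropy p)%E].

End Densities.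

(* Main.v *)
Require Import Defs.
From mathcomp Require Import all_boot all_order all_algebra.
From mathcomp Require Import finmap ring lra.
From mathcomp Require Import all_classical all_reals all_analysis.
Local Open Scope ring_scope.

(* Up to a constant, ln p_theta is a quadratic polynomial in n, so the cross
   entropy - sum q ln p_theta depends on q only through its mean and covariance;
   it is thus the same for all q in the class, p_theta included. Gibbs'
   inequality bounds the entropy of q by this cross entropy, which for
   q = p_theta is the entropy of p_theta.

   The moments exist because Cauchy-Schwarz for B makes n^t B n dominate a
   multiple of |n|^2, whence p_theta(n) (1 + |n|^2) = O(prod_i 1/(1 + n_i^2)). *)

Set Implicit Arguments.
Unset Strict Implicit.
Unset Printing Implicit Defensive.
Import Order.TTheory GRing.Theory Num.Theory.
Local Open Scope classical_set_scope.

(** * Linearity of sums of absolutely summable real families *)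

Section AbsoluteSums.
Variables (R : realType) (T : choiceType).
Implicit Types (f g h : T -> R) (s t c : R).

(** Summability is bundled with the value because [rsum] alone is junk without it. *)
Definition has_rsum f s := summable setT (EFin \o f) /\ rsum f = s.

Lemma ge0_summable f s : (forall x, 0 <= f x) ->
  (\esum_(x in setT) (f x)%:E <= s%:E)%E -> summable setT (EFin \o f).
Proof.
move=> f0 fs; rewrite /summable; apply: le_lt_trans (ltry s).
by under eq_esum do rewrite /= ger0_norm//.
Qed.

Lemma summable_le f g : (forall x, `|f x| <= g x) ->
  summable setT (EFin \o g) -> summable setT (EFin \o f).
Proof.
move=> fg; apply: le_lt_trans; apply: le_esum => x _ /=.
by rewrite lee_fin (le_trans (fg x))// ler_norm.
Qed.

(** The negative part of [f] vanishes, so [rsum] is the [esum], and a real value [s] forces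
    summability. Densities enter and leave the calculus through this bridge. *)
Lemma ge0_has_rsum f s : (forall x, 0 <= f x) ->
  has_rsum f s <-> \esum_(x in setT) (f x)%:E = s%:E.
Proof.
move=> f0.
have absE : \esum_(x in setT) `|(EFin \o f) x|%E = \esum_(x in setT) (f x)%:E.
  by apply: eq_esum => x _ /=; rewrite ger0_norm.
have posE : esum setT (EFin \o f)^\+%E = \esum_(x in setT) (f x)%:E.
  by apply: eq_esum => x Tx; apply: (ge0_funeposE (D := setT));
    rewrite ?inE// => y _; rewrite lee_fin.
have negE : esum setT (EFin \o f)^\-%E = 0%E.
  by apply: esum1 => x Tx; apply: (ge0_funenegE (D := setT));
    rewrite ?inE// => y _; rewrite lee_fin.
rewrite /has_rsum summableE absE /rsum posE negE sube0.
split=> [[fin <-]|->]; last by [].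
by rewrite fineK.
Qed.

Lemma ge0_has_rsumB f g s t : (forall x, 0 <= f x) -> (forall x, 0 <= g x) ->
  has_rsum f s -> has_rsum g t -> has_rsum (fun x => f x - g x) (s - t).
Proof.
move=> f0 g0 hf hg; split.
  by apply: (@summableB _ _ _ (EFin \o f) (EFin \o g)); [case: hf|case: hg].
have /= := @esumB _ _ setT (EFin \o f) (EFin \o g) hf.1 hg.1
  (fun x _ => f0 x) (fun x _ => g0 x).
move/(ge0_has_rsum s f0): hf => -> /(ge0_has_rsum t g0) in hg *.
by rewrite hg /rsum => ->.
Qed.

Lemma summable_has_rsum f : summable setT (EFin \o f) -> has_rsum f (rsum f).
Proof. by []. Qed.

(* f = (|f| + f) - |f| reduces statements to nonnegative families. *)
Lemma has_rsum_split f s : has_rsum f s ->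
  exists g h a b, [/\ (forall x, 0 <= g x), (forall x, 0 <= h x),
    has_rsum g a, has_rsum h b &
    f = (fun x => g x - h x) /\ s = a - b].
Proof.
move=> hf; pose g x := `|f x| + f x; pose h x := `|f x|.
have sh : summable setT (EFin \o h).
  by apply: le_lt_trans hf.1; apply: le_esum => x _ /=; rewrite normr_id.
have sg : summable setT (EFin \o g).
  by apply: (@summableD _ _ _ (EFin \o h) (EFin \o f)) => //; case: hf.
have g0 x : 0 <= g x by rewrite /g; have := ler_norm (- f x); rewrite normrN; lra.
have h0 x : 0 <= h x by exact: normr_ge0.
exists g, h, (rsum g), (rsum h).
have fE : f = (fun x => g x - h x) by apply/funext => x; rewrite /g /h; lra.
split=> //; split=> //; case: hf => _ <-.
rewrite [in LHS]fE.
by have [] := ge0_has_rsumB g0 h0 (summable_has_rsum sg) (summable_has_rsum sh).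
Qed.

Lemma ge0_has_rsumD f g s t : (forall x, 0 <= f x) -> (forall x, 0 <= g x) ->
  has_rsum f s -> has_rsum g t -> has_rsum (fun x => f x + g x) (s + t).
Proof.
move=> f0 g0 /ge0_has_rsum -/(_ f0) hf /ge0_has_rsum -/(_ g0) hg.
apply/ge0_has_rsum => [x|]; first exact: addr_ge0.
by under eq_esum do rewrite EFinD; rewrite esumD ?hf ?hg// => x _; rewrite lee_fin.
Qed.

Lemma ge0_has_rsumZ c f s : 0 <= c -> (forall x, 0 <= f x) ->
  has_rsum f s -> has_rsum (fun x => c * f x) (c * s).
Proof.
move=> c0 f0 /ge0_has_rsum -/(_ f0) hf.
apply/ge0_has_rsum => [x|]; first exact: mulr_ge0.
(* The scalar moves inside the supremum over finite subsets, then into each finite sum. The set of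
   partial sums must be nonempty: the empty sum is the witness. *)
rewrite EFinM -hf /esum -ereal_supZl//; last first.
  apply/set0P; exists (\sum_(x \in set0) (f x)%:E)%E.
  by exists set0; first exact: fsets_set0.
rewrite image_comp; congr ereal_sup; apply: eq_imagel => A _ /=.
by rewrite ge0_mule_fsumr.
Qed.

Lemma has_rsumD f g s t :
  has_rsum f s -> has_rsum g t -> has_rsum (fun x => f x + g x) (s + t).
Proof.
move=> /has_rsum_split[f1 [f2 [a1 [a2 [f10 f20 hf1 hf2 [-> ->]]]]]].
move=> /has_rsum_split[g1 [g2 [b1 [b2 [g10 g20 hg1 hg2 [-> ->]]]]]].
have -> : a1 - a2 + (b1 - b2) = (a1 + b1) - (a2 + b2) by ring.
have -> : (fun x => f1 x - f2 x + (g1 x - g2 x)) =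
    (fun x => (f1 x + g1 x) - (f2 x + g2 x)) by apply/funext => x; ring.
by apply: ge0_has_rsumB; [| |exact: ge0_has_rsumD..] => x; exact: addr_ge0.
Qed.

Lemma has_rsumZ c f s : has_rsum f s -> has_rsum (fun x => c * f x) (c * s).
Proof.
move=> /has_rsum_split[g [h [a [b [g0 h0 hg hh [-> ->]]]]]].
have [c0|c0] := leP 0 c.
  have -> : (fun x => c * (g x - h x)) = (fun x => c * g x - c * h x).
    by apply/funext => x; ring.
  rewrite mulrBr.
  by apply: ge0_has_rsumB; [| |exact: ge0_has_rsumZ..] => x; exact: mulr_ge0.
(* A negative scalar exchanges the roles of the two nonnegative parts. *)
have c0' : 0 <= - c by lra.
have -> : (fun x => c * (g x - h x)) = (fun x => (- c) * h x - (- c) * g x).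
  by apply/funext => x; ring.
have -> : c * (a - b) = (- c) * b - (- c) * a by ring.
by apply: ge0_has_rsumB; [| |exact: ge0_has_rsumZ..] => x; exact: mulr_ge0.
Qed.

Lemma has_rsum_sum (I : Type) (r : seq I) (f : I -> T -> R) (s : I -> R) :
  (forall i, has_rsum (f i) (s i)) ->
  has_rsum (fun x => \sum_(i <- r) f i x) (\sum_(i <- r) s i).
Proof.
move=> hf; elim: r => [|i r ih].
  rewrite big_nil; under eq_fun do rewrite big_nil.
  by apply/ge0_has_rsum => //; exact: esum1.
rewrite big_cons; under eq_fun do rewrite big_cons.
exact: has_rsumD.
Qed.
End AbsoluteSums.

(** * Positive definite forms: Cauchy-Schwarz and coercivity *)

Section QuadraticForms.
Variables (R : realType) (g : nat).
Implicit Types (B : 'M[R]_g) (x y : 'cV[R]_g).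

Definition bilin B x y : R := (x^T *m B *m y) 0 0.

Lemma bilinE B x y : bilin B x y = \sum_i \sum_j B i j * (x i 0 * y j 0).
Proof.
rewrite /bilin mxE exchange_big /=; apply: eq_bigr => j _.
by rewrite mxE big_distrl /=; apply: eq_bigr => i _; rewrite mxE; ring.
Qed.

(** A nonzero row [v] of the left kernel would give [v B v^T = 0], against positivity. *)
Lemma posdefmx_unit B : posdefmx B -> B \in unitmx.
Proof.
move=> [Bsym Bpos]; rewrite -row_free_unit -kermx_eq0.
apply/eqP/row_matrixP => i.
rewrite row0; apply/eqP; apply: contraT => nz.
have := Bpos (row i (kermx B))^T; rewrite trmxK -row_mul mulmx_ker row0 mul0mx.
by rewrite mxE ltxx => ->//; rewrite -[X in _ != X]trmx0 (inj_eq trmx_inj).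
Qed.

Lemma posdefmx_ge0 B x : posdefmx B -> 0 <= bilin B x x.
Proof.
move=> [_ Bpos]; have [->|/Bpos/ltW//] := eqVneq x 0.
by rewrite /bilin mulmx0 mxE.
Qed.

Lemma bilinC B x y : B^T = B -> bilin B x y = bilin B y x.
Proof.
move=> Bsym; transitivity ((x^T *m B *m y)^T 0 0); first by rewrite mxE.
by rewrite !trmx_mul trmxK Bsym mulmxA.
Qed.

Lemma bilinB B t x y : B^T = B ->
  bilin B (x - t *: y) (x - t *: y) =
  bilin B x x - 2 * t * bilin B x y + t ^+ 2 * bilin B y y.
Proof.
move=> Bsym; rewrite /bilin.
have -> : (x - t *: y)^T = x^T - t *: y^T by rewrite linearB linearZ.
rewrite !(mulmxBl, mulmxBr) -!(scalemxAl, scalemxAr) !mxE.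
by have := bilinC y x Bsym; rewrite /bilin !mxE => ->; ring.
Qed.

Lemma bilin_CauchySchwarz B x y : posdefmx B ->
  bilin B x y ^+ 2 <= bilin B x x * bilin B y y.
Proof.
move=> Bpd; have [Bsym Bpos] := Bpd.
have [->|y0] := eqVneq y 0.
  by rewrite /bilin !mulmx0 !mxE expr0n mulr0.
have yy : 0 < bilin B y y by exact: Bpos.
(* This multiple of [y] minimises the form along [x - t y]; the minimum times [bilin B y y] is the
   difference of the two sides. *)
have := posdefmx_ge0 (x - (bilin B x y / bilin B y y) *: y) Bpd.
rewrite bilinB// -(pmulr_lge0 _ yy).
rewrite -[bilin B x y ^+ 2 <= _]subr_ge0; congr (0 <= _).
by field; rewrite gt_eqF.
Qed.

(* Cauchy-Schwarz applies since x_i is the B-product of x and B^-1 e_i. *)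
Lemma posdefmx_coercive B : posdefmx B ->
  exists2 c, 0 < c & forall x, c * \sum_i x i 0 ^+ 2 <= bilin B x x.
Proof.
move=> Bpd; have Bu := posdefmx_unit Bpd.
pose e i : 'cV[R]_g := invmx B *m delta_mx i 0.
pose C := 1 + \sum_i bilin B (e i) (e i).
have C0 : 0 < C by rewrite ltr_wpDr// sumr_ge0// => i _; exact: posdefmx_ge0.
exists C^-1 => [|x]; first by rewrite invr_gt0.
rewrite mulrC ler_pdivrMr//.
have xE i : x i 0 = bilin B x (e i).
  by rewrite /bilin -mulmxA mulKVmx// -colE !mxE.
apply: (@le_trans _ _ (\sum_i bilin B x x * bilin B (e i) (e i))).
  by apply: ler_sum => i _; rewrite xE; exact: bilin_CauchySchwarz.
by rewrite -mulr_sumr ler_wpM2l ?posdefmx_ge0// lerDr.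
Qed.
End QuadraticForms.

(** * A summable product bound on the integer lattice *)

Section Lattice.
Variables (R : realType) (g : nat).
Implicit Types (n : 'cV[int]_g).

(* t / (1 + |t|) is bounded, so the bound makes sum_k 1/(1 + k^2) telescope. *)
Lemma inv1Dsqr_le_telescope (k : int) (psi := fun t : R => t / (1 + `|t|)) :
  (1 + k%:~R ^+ 2)^-1 <= 4 * (psi (k + 1)%:~R - psi k%:~R).
Proof.
rewrite /psi rmorphD /= mulr1z; set t : R := k%:~R.
have t2 : 0 <= t ^+ 2 := sqr_ge0 t.
rewrite -[_^-1]mul1r ler_pdivrMr; last by lra.
have [k0|k0] := leP 0 k.
  have t0 : 0 <= t by rewrite ler0z.
  rewrite !ger0_norm ?addr_ge0//.
  have -> : 4 * ((t + 1) / (1 + (t + 1)) - t / (1 + t)) * (1 + t ^+ 2) =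
      4 * (1 + t ^+ 2) / ((t + 1) * (t + 2))
    by field; rewrite !gt_eqF ?andbT; lra.
  rewrite ler_pdivlMr; last by rewrite mulr_gt0; lra.
  by have := sqr_ge0 (2 * t - 1); nra.
(* Integrality: [k < 0] forces [k + 1 <= 0], so [t] and [t + 1] lie on the same side of 0 and both
   absolute values resolve. *)
have t0 : t + 1 <= 0 by rewrite -[1]/(1%:~R) -intrD lerz0 -ltzD1 ltrD2r.
rewrite !ler0_norm//; last by lra.
have -> : 4 * ((t + 1) / (1 - (t + 1)) - t / (1 - t)) * (1 + t ^+ 2) =
    4 * (1 + t ^+ 2) / (- t * (1 - t))
  by field; repeat (apply/andP; split); apply/eqP; lra.
rewrite ler_pdivlMr; last by rewrite mulr_gt0; lra.
by have := sqr_ge0 (2 * t + 1); nra.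
Qed.

(** The values of [psi] lie in [-1, 1], so the telescoped sum is at most 4 * 2 for every window of
    integers. The shift by [N] lets ordinals index negative integers. *)
Lemma sum_inv1Dsqr_le (N M : nat) :
  \sum_(j < M) (1 + (j%:Z - N%:Z)%:~R ^+ 2)^-1 <= 8 :> R.
Proof.
pose psi (t : R) := t / (1 + `|t|).
have psi1 t : `|psi t| <= 1.
  have t0 : 0 <= `|t| by exact: normr_ge0.
  by rewrite normrM normfV [X in _ / X]ger0_norm ?ler_pdivrMr; lra.
pose f (j : nat) : R := 4 * psi (j%:Z - N%:Z)%:~R.
rewrite -(big_mkord xpredT (fun j : nat => (1 + (j%:Z - N%:Z)%:~R ^+ 2)^-1)).
apply: (@le_trans _ _ (\sum_(0 <= j < M) (f j.+1 - f j))).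
  apply: ler_sum => j _; rewrite -mulrBr.
  rewrite (_ : j.+1%:Z - N%:Z = j%:Z - N%:Z + 1); first exact: inv1Dsqr_le_telescope.
  by rewrite -addn1 PoszD; ring.
rewrite telescope_sumr// /f.
have := psi1 (M%:Z - N%:Z)%:~R; have := psi1 (0%:Z - N%:Z)%:~R.
by rewrite !ler_norml => /andP[? ?] /andP[? ?]; lra.
Qed.

(** The points lie in the box [-N, N]^g, and the sum over the whole box factors into [g]
    one-dimensional sums, each at most 8. *)
Lemma sum_prod_inv1Dsqr_le (s : seq 'cV[int]_g) (N : nat) : uniq s ->
  (forall n i, n \in s -> (`|n i ord0| <= N)%N) ->
  \sum_(n <- s) \prod_i (1 + (n i 0)%:~R ^+ 2)^-1 <= 8 ^+ g :> R.
Proof.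
move=> us sN; pose J := 'I_(N + N).+1.
(* The shifted coordinates lie in [0, 2N], so neither the absolute value nor [inord] loses
   information. *)
pose phi n : {ffun 'I_g -> J} := [ffun i => inord `|(n i ord0 + N%:Z)%R|%N].
have phiK n i : n \in s -> (phi n i : nat)%:Z - N%:Z = n i 0.
  move=> /sN -/(_ i); rewrite ffunE -lez_nat abszE ler_norml => /andP[nN Nn].
  have n0 : 0 <= n i 0 + N%:Z by rewrite addrC -lerBlDl sub0r.
  rewrite inordK; first by rewrite gez0_abs//; ring.
  by rewrite ltnS -lez_nat gez0_abs// PoszD lerD2r.
pose w (v : {ffun 'I_g -> J}) : R :=
  \prod_i (1 + ((v i : nat)%:Z - N%:Z)%:~R ^+ 2)^-1.
have w0 v : 0 <= w v.
  by apply: prodr_ge0 => i _; rewrite invr_ge0 addr_ge0// sqr_ge0.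
have -> : \sum_(n <- s) \prod_i (1 + (n i 0)%:~R ^+ 2)^-1 =
    \sum_(v <- map phi s) w v.
  rewrite big_map; apply: eq_big_seq => n ns.
  by apply: eq_bigr => i _; rewrite phiK.
have phi_inj : {in s &, injective phi}.
  move=> m n ms ns mn; apply/colP => i.
  by rewrite -(phiK m i ms) -(phiK n i ns) mn.
rewrite big_uniq ?map_inj_in_uniq//=.
apply: (@le_trans _ _ (\sum_v w v)).
  by rewrite big_mkcond /=; apply: ler_sum => v _; case: ifP.
rewrite -(bigA_distr_bigA
  (fun _ (j : J) => (1 + ((j : nat)%:Z - N%:Z)%:~R ^+ 2)^-1)).
rewrite -[X in _ <= 8 ^+ X]card_ord -prodr_const; apply: ler_prod => i _.
rewrite sum_inv1Dsqr_le andbT sumr_ge0// => j _.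
by rewrite invr_ge0 addr_ge0// sqr_ge0.
Qed.

(** The bound [8 ^+ g] does not depend on the box, so it survives the supremum over finite sets. *)
Lemma summable_prod_inv1Dsqr :
  summable setT (EFin \o fun n => \prod_i (1 + (n i 0)%:~R ^+ 2 : R)^-1).
Proof.
apply: (@ge0_summable _ _ _ (8 ^+ g)) => [n|].
  by apply: prodr_ge0 => i _; rewrite invr_ge0 addr_ge0// sqr_ge0.
apply: ge_ereal_sup => _ [A [finA _] <-].
rewrite fsbig_finite//= sumEFin lee_fin.
pose N := (\max_(n <- fset_set A) \max_i `|n i ord0|)%N.
apply: (@sum_prod_inv1Dsqr_le _ N) => [|n i nA]; first exact: fset_uniq.
rewrite /N (big_rem n)//= leq_max; apply/orP; left.
exact: (leq_bigmax i).
Qed.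

(** * Gaussian decay of the theta terms *)

Lemma ebold_gt0 (x : R) : 0 < ebold x. Proof. exact: expR_gt0. Qed.

Lemma realvec_bilin (B : 'M[R]_g) n :
  ((realvec R n)^T *m B *m realvec R n) 0 0 =
  bilin B (realvec R n) (realvec R n).
Proof. by []. Qed.

Lemma realvec_dot (u : 'cV[R]_g) n :
  ((realvec R n)^T *m u) 0 0 = \sum_i (n i 0)%:~R * u i 0.
Proof. by rewrite mxE; apply: eq_bigr => i _; rewrite !mxE. Qed.

(** Absorbs a polynomial factor into an arbitrarily slow exponential, by way of
    [1 + b * t <= expR (b * t)]. *)
Lemma Dx_le_expR (b t : R) : 0 < b -> 0 <= t ->
  1 + t <= (1 + b^-1) * expR (b * t).
Proof.
move=> b0 t0; have c0 : 0 < b^-1 by rewrite invr_gt0.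
apply: (@le_trans _ _ ((1 + b^-1) * (1 + b * t))).
  have bt : b^-1 * (b * t) = t by rewrite mulKf// gt_eqF.
  by have : 0 <= b * t by [rewrite mulr_ge0// ltW]; lra.
by rewrite ler_wpM2l// ?expR_ge1Dx//; lra.
Qed.

Lemma summable_theta_moment (u : 'cV[R]_g) (B : 'M[R]_g) : posdefmx B ->
  summable setT
    (EFin \o fun n => (1 + \sum_i (n i 0)%:~R ^+ 2) * theta_term u B n).
Proof.
move=> /posdefmx_coercive[c c0 cB].
(* Coercivity gives the decay [- pi * c * S]. Half of it absorbs the linear term at the cost of [K];
   the other half is [- 2 * a * S], used as two factors: one for [1 + S], one for the product over
   coordinates. *)
pose a : R := pi * c / 4; pose C := 1 + a^-1.
pose K : R := 2 * pi * \sum_i u i 0 ^+ 2 / c.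
have a0 : 0 < a by rewrite divr_gt0// mulr_gt0// pi_gt0.
have C0 : 0 < C by rewrite addr_gt0// invr_gt0.
have hs := has_rsumZ (C * expR K * C ^+ g)
  (summable_has_rsum summable_prod_inv1Dsqr).
apply: summable_le hs.1 => n /=.
set S : R := \sum_i _.
have S0 : 0 <= S by rewrite sumr_ge0// => i _; exact: sqr_ge0.
have S1 : 0 <= 1 + S by rewrite addr_ge0.
rewrite ger0_norm ?mulr_ge0//; last exact/ltW/ebold_gt0.
have thetaE : theta_term u B n <= expR K * expR (- (a * S)) * expR (- (a * S)).
  rewrite -!expRD ler_expR.
  have -> : K - a * S - a * S =
      2 * pi * (- (c / 4) * S + \sum_i u i 0 ^+ 2 / c).
    by rewrite /K /a; field.
  rewrite ler_wpM2l ?mulr_ge0 ?pi_ge0// realvec_bilin realvec_dot.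
  have := cB (realvec R n).
  have -> : \sum_i realvec R n i 0 ^+ 2 = S.
    by apply: eq_bigr => i _; rewrite mxE.
  (* The linear term is bounded coordinatewise by completing the square. *)
  have : \sum_i (n i 0)%:~R * u i 0 <= c / 4 * S + \sum_i u i 0 ^+ 2 / c.
    rewrite mulr_sumr -big_split /=; apply: ler_sum => i _.
    set x : R := (n i 0)%:~R; set y := u i 0.
    have : 0 <= (c / 2 * x - y) ^+ 2 / c by rewrite divr_ge0 ?sqr_ge0// ltW.
    have -> : (c / 2 * x - y) ^+ 2 / c = c / 4 * x ^+ 2 - x * y + y ^+ 2 / c.
      by field; rewrite gt_eqF.
    by lra.
  by lra.
have prodE : expR (- (a * S)) <= C ^+ g * \prod_i (1 + (n i 0)%:~R ^+ 2)^-1.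
  rewrite -[X in C ^+ X]card_ord -prodr_const -big_split /=.
  rewrite /S mulr_sumr -sumrN expR_sum; apply: ler_prod => i _.
  rewrite expR_ge0 /= expRN -[_^-1]mul1r ler_pdivrMr ?expR_gt0//.
  rewrite -mulrA mulrCA mulrC ler_pdivlMr ?mul1r.
    exact: Dx_le_expR (sqr_ge0 _).
  by rewrite ltr_wpDr ?sqr_ge0.
have SE : (1 + S) * expR (- (a * S)) <= C.
  by rewrite expRN ler_pdivrMr ?expR_gt0//; exact: Dx_le_expR.
apply: (le_trans (ler_wpM2l S1 thetaE)).
have -> : (1 + S) * (expR K * expR (- (a * S)) * expR (- (a * S))) =
  ((1 + S) * expR (- (a * S)) * expR K) * expR (- (a * S)) by ring.
rewrite -[_ * C ^+ g * _]mulrA; apply: ler_pM => //.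
- by rewrite !mulr_ge0 ?expR_ge0// addr_ge0.
- by rewrite ler_wpM2r ?expR_ge0.
Qed.
End Lattice.

(** * Gibbs' inequality *)

Section Gibbs.
Variables (R : realType) (T : choiceType).
Implicit Types (p q : T -> R).

Lemma has_rsum1_le1 q x : (forall y, 0 <= q y) -> has_rsum q 1 -> q x <= 1.
Proof.
move=> q0 /ge0_has_rsum -/(_ q0) q1; rewrite -lee_fin -q1.
by apply: esum_ge; exists [set x]; rewrite ?fsbig_set1//; split.
Qed.

Lemma ge0_NMln (t : R) : 0 <= t -> t <= 1 -> 0 <= - (t * ln t).
Proof. by move=> t0 t1; rewrite -mulrN mulr_ge0// oppr_ge0 ln_le0. Qed.

(** This is [ln (1 + x) <= x] at [x = t / s - 1], multiplied by [s]; for [s = 0] the factor [s]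
    kills the logarithm. *)
Lemma NMln_le (s t : R) : 0 <= s -> 0 < t -> - (s * ln s) <= s * - ln t + t - s.
Proof.
rewrite le_eqVlt => /predU1P[<-|s0] t0; first by rewrite !mul0r; lra.
have := @le_ln1Dx _ (t / s - 1).
rewrite [1 + _]addrC subrK ltrBrDr addNr divr_gt0// => /(_ isT).
rewrite ln_div ?posrE// => /(ler_wpM2l (ltW s0)).
have -> : s * (t / s - 1) = t - s by field; rewrite gt_eqF.
by lra.
Qed.

(** The pointwise bound [NMln_le] is summed; its extra terms [p x] and [- q x] have total 1 - 1 =
    0. *)
Lemma gibbs p q s : (forall x, 0 <= q x) -> (forall x, 0 < p x) ->
  has_rsum q 1 -> has_rsum p 1 -> has_rsum (fun x => q x * - ln (p x)) s ->
  (\esum_(x in setT) (- (q x * ln (q x)))%:E <= s%:E)%E.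
Proof.
move=> q0 p0 q1 p1 qp.
have /ge0_has_rsum hs := has_rsumD (has_rsumD qp p1) (has_rsumZ (-1) q1).
rewrite (_ : s = s + 1 + -1 * 1); last by ring.
have qle x : - (q x * ln (q x)) <= q x * - ln (p x) + p x + -1 * q x.
  by rewrite mulN1r; exact: NMln_le.
(* [hs] requires a nonnegative majorant: it lies above [- (q x * ln (q x))], which is nonnegative
   since [q x <= 1]. *)
rewrite -hs => [|x]; first by apply: le_esum => x _; rewrite lee_fin.
apply: le_trans (qle x); apply: ge0_NMln => //; exact: has_rsum1_le1.
Qed.
End Gibbs.

(** * Normalisation, moments and cross entropy of the discrete Gaussian *)

Section DiscreteGaussianMoments.
Variables (R : realType) (g : nat) (u : 'cV[R]_g) (B : 'M[R]_g).
Hypothesis Bpd : posdefmx B.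
Implicit Types (n : 'cV[int]_g) (q : 'cV[int]_g -> R).
Local Notation p := (p_theta u B).

Lemma theta_term_gt0 n : 0 < theta_term u B n. Proof. exact: ebold_gt0. Qed.

Lemma summable_theta_term : summable setT (EFin \o theta_term u B).
Proof.
apply: summable_le (summable_theta_moment u Bpd) => n /=.
rewrite ger0_norm ?(ltW (theta_term_gt0 n))//.
rewrite ler_peMl ?(ltW (theta_term_gt0 n))// lerDl sumr_ge0// => i _.
exact: sqr_ge0.
Qed.

(** Summability makes the series finite, so [fine] in [theta] loses nothing. *)
Lemma theta_has_rsum : has_rsum (theta_term u B) (theta u B).
Proof.
have t0 n := ltW (theta_term_gt0 n).
have /ge0_has_rsum -/(_ t0) hs := summable_has_rsum summable_theta_term.
by apply/ge0_has_rsum => //; rewrite /theta hs.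
Qed.

Lemma theta_gt0 : 0 < theta u B.
Proof.
apply: lt_le_trans (theta_term_gt0 0) _; rewrite -lee_fin.
have /ge0_has_rsum <- := theta_has_rsum; last first.
  by move=> n; exact/ltW/theta_term_gt0.
by apply: esum_ge; exists [set 0]; rewrite ?fsbig_set1//; split.
Qed.

Lemma p_theta_gt0 n : 0 < p n.
Proof. by rewrite mulr_gt0 ?invr_gt0 ?theta_gt0 ?theta_term_gt0. Qed.

Lemma p_theta_has_rsum : has_rsum p 1.
Proof.
rewrite -(mulVf (x := theta u B)) ?gt_eqF ?theta_gt0//.
exact: has_rsumZ theta_has_rsum.
Qed.

Lemma summable_p_theta (f : 'cV[int]_g -> R) :
  (forall n, `|f n| <= 1 + \sum_i (n i 0)%:~R ^+ 2) ->
  summable setT (EFin \o (fun n => p n * f n)).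
Proof.
move=> fS; have hs := has_rsumZ (theta u B)^-1
  (summable_has_rsum (summable_theta_moment u Bpd)).
apply: summable_le hs.1 => n /=.
rewrite normrM gtr0_norm ?p_theta_gt0// mulrCA mulrC.
by rewrite ler_wpM2r// ltW// p_theta_gt0.
Qed.

Lemma summable_p_theta_mean i : summable setT (EFin \o mean_term p i).
Proof.
apply: summable_p_theta => n; rewrite (bigD1 i)//=.
have : 0 <= \sum_(j | j != i) (n j 0)%:~R ^+ 2 :> R.
  by apply: sumr_ge0 => j _; exact: sqr_ge0.
set x : R := (n i 0)%:~R => ?.
rewrite -real_normK ?num_real//.
by have := sqr_ge0 (`|x| - 2^-1); lra.
Qed.

Lemma summable_p_theta_mul i j :
  summable setT (EFin \o (fun n => p n * ((n i 0)%:~R * (n j 0)%:~R))).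
Proof.
apply: summable_p_theta => n; set x : 'I_g -> R := fun k => (n k 0)%:~R.
have xS k : x k ^+ 2 <= \sum_l x l ^+ 2.
  rewrite (bigD1 k)//= lerDl; apply: sumr_ge0 => l _; exact: sqr_ge0.
rewrite -/(x i) -/(x j) normrM; change (`|x i| * `|x j| <= 1 + \sum_l x l ^+ 2).
(* The product [|x i| * |x j|] is at most the mean of the two squares, including when [i = j]. *)
have := xS i; have := xS j; have := sqr_ge0 (`|x i| - `|x j|).
rewrite -(real_normK (num_real (x i))) -(real_normK (num_real (x j))).
rewrite sqrrB -mulr_natr.
by lra.
Qed.

(** Expanding the centred product leaves a mixed second moment, two first moments and the total
    mass. *)
Lemma summable_p_theta_cov i j : summable setT (EFin \o cov_term p i j).
Proof.
pose mi := mean p i 0; pose mj := mean p j 0.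
have := has_rsumD
  (has_rsumD (summable_has_rsum (summable_p_theta_mul i j))
    (has_rsumZ (- mj) (summable_has_rsum (summable_p_theta_mean i))))
  (has_rsumD
    (has_rsumZ (- mi) (summable_has_rsum (summable_p_theta_mean j)))
    (has_rsumZ (mi * mj) p_theta_has_rsum)).
case=> + _; congr (summable _ (_ \o _)); apply/funext => n.
by rewrite /cov_term /mean_term -/mi -/mj; ring.
Qed.

Lemma p_theta_moment_class : moment_class (mean p) (covmx p) p.
Proof.
split; [split| |split|split] => //.
- by move=> n; exact/ltW/p_theta_gt0.
- by apply/ge0_has_rsum; [move=> n; exact/ltW/p_theta_gt0|exact: p_theta_has_rsum].
- by apply/seteqP; split=> // n _ /=; rewrite gt_eqF ?p_theta_gt0.
- exact: summable_p_theta_mean.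
- exact: summable_p_theta_cov.
Qed.

(** Recentring the form at [mu] turns the quadratic part into centred products, whose sums against a
    density of mean [mu] are its covariances. *)
Lemma Nln_p_theta (mu : 'cV[R]_g) n :
  - ln (p n) = (ln (theta u B) - pi * bilin B mu mu)
    + \sum_i (2 * pi * ((B *m mu) i 0 - u i 0)) * (n i 0)%:~R
    + \sum_i \sum_j (pi * B i j)
      * (((n i 0)%:~R - mu i 0) * ((n j 0)%:~R - mu j 0)).
Proof.
rewrite lnM ?posrE ?invr_gt0 ?theta_gt0 ?theta_term_gt0//.
rewrite lnV ?posrE ?theta_gt0//.
rewrite expRK realvec_bilin realvec_dot; set x := realvec R n.
have xE i : x i 0 = (n i 0)%:~R by rewrite mxE.
have -> : \sum_i \sum_j (pi * B i j)
      * (((n i 0)%:~R - mu i 0) * ((n j 0)%:~R - mu j 0)) =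
    pi * bilin B (x - mu) (x - mu).
  rewrite bilinE mulr_sumr; apply: eq_bigr => i _; rewrite mulr_sumr.
  by apply: eq_bigr => j _; rewrite !mxE mulrA.
have := bilinB 1 x mu Bpd.1; rewrite scale1r => ->.
have -> : \sum_i (2 * pi * ((B *m mu) i 0 - u i 0)) * (n i 0)%:~R =
    2 * pi * (bilin B x mu - \sum_i (n i 0)%:~R * u i 0).
  rewrite /bilin -mulmxA mxE -sumrB mulr_sumr; apply: eq_bigr => i _.
  by rewrite !mxE; ring.
by field.
Qed.

Lemma cross_entropy_p_theta (mu : 'cV[R]_g) (Sigma : 'M[R]_g) :
  exists s, forall q, moment_class mu Sigma q ->
    has_rsum (fun n => q n * - ln (p n)) s.
Proof.
(* The expansion of [- ln (p n)] with 1, [n i 0] and the centred products replaced by the total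
   mass, [mu] and [Sigma]; hence [s] is fixed before [q]. *)
exists ((ln (theta u B) - pi * bilin B mu mu) * 1
  + \sum_i (2 * pi * ((B *m mu) i 0 - u i 0)) * mu i 0
  + \sum_i \sum_j (pi * B i j) * Sigma i j) => q.
move=> [[q0 q1] _ [qmean qmu] [qcov qSigma]].
have hq : has_rsum q 1 by apply/ge0_has_rsum.
have hmean i : has_rsum (mean_term q i) (mu i 0).
  by split=> //; rewrite -qmu mxE.
have hcov i j : has_rsum (cov_term q i j) (Sigma i j).
  by split=> //; rewrite -qSigma mxE.
pose b i := 2 * pi * ((B *m mu) i 0 - u i 0).
have := has_rsumD
  (has_rsumD (has_rsumZ (ln (theta u B) - pi * bilin B mu mu) hq)
    (has_rsum_sum (index_enum _) (fun i => has_rsumZ (b i) (hmean i))))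
  (has_rsum_sum (index_enum _) (fun i => has_rsum_sum (index_enum _)
    (fun j => has_rsumZ (pi * B i j) (hcov i j)))).
congr (has_rsum _ _); apply/funext => n; rewrite (Nln_p_theta mu) 2!mulrDr.
congr (_ + _ + _); first by ring.
  by rewrite mulr_sumr; apply: eq_bigr => i _; rewrite /mean_term /b; ring.
rewrite mulr_sumr; apply: eq_bigr => i _; rewrite mulr_sumr.
by apply: eq_bigr => j _; rewrite /cov_term qmu; ring.
Qed.
End DiscreteGaussianMoments.

Theorem corollary2p11 (R : realType) (g : nat) (hg : (1 <= g)%N)
    (u : 'cV[R]_g) (B : 'M[R]_g) (hB : posdefmx B)
    (mu : 'cV[R]_g) (hmu : mu = mean (p_theta u B))
    (Sigma : 'M[R]_g) (hSigma : Sigma = covmx (p_theta u B)) :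
  maximizes_entropy (moment_class mu Sigma) (p_theta u B).
Proof.
have pC : moment_class mu Sigma (p_theta u B).
  by rewrite hmu hSigma; exact: p_theta_moment_class.
have [s hs] := cross_entropy_p_theta u hB mu Sigma.
have p0 := p_theta_gt0 u hB.
have p1 := p_theta_has_rsum u hB.
(* For [q = p_theta] the cross entropy is the entropy term by term; [s] being real, this also gives
   finiteness. *)
have entropyE : entropy (p_theta u B) = s%:E.
  have /ge0_has_rsum <- := hs _ pC.
    by apply: eq_esum => n _; rewrite mulrN.
  move=> n; rewrite mulrN; apply: ge0_NMln; first exact: ltW.
  by apply: has_rsum1_le1 p1 => m; exact: ltW.
split=> //; first by rewrite entropyE.
move=> q qC; rewrite entropyE; have [[q0 q1] _ _ _] := qC.
by apply: (gibbs q0 p0 _ p1 (hs _ qC)); apply/ge0_has_rsum.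
Qed.
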